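(* If a Tychonoff space $X$ carries a JN-sequence, then either there is a JN-sequence $\langle\mu_n\colon n\in\omega\rangle$ on $X$ such that $|\operatorname{supp}(\mu_n)|=2$ for every $n\in\omega$, or each JN-sequence $\langle\mu_n\colon n\in\omega\rangle$ on $X$ satisfies $\lim_{n\to\infty}|\operatorname{supp}(\mu_n)|=\infty$.
   Context: $C(X)$ is the set of all (not necessarily bounded) continuous functions $X\to\mathbb{R}$. A finitely supported (signed Borel) measure on $X$ is a finite linear combination $\mu=\sum_{x\in F}\alpha_x\delta_x$ of one-point (Dirac) measures, with $F\subseteq X$ finite and $\alpha_x\in\mathbb{R}\setminus\{0\}$ for $x\in F$; its support is $\operatorname{supp}(\mu)=F$, its norm is $\|\mu\|=\sum_{x\in F}|\alpha_x|$, and $\mu(f)=\int_X f\,d\mu=\sum_{x\in F}\alpha_xf(x)$. A JN-sequence on a Tychonoff space $X$ is a sequence $\langle\mu_n\colon n\in\omega\rangle$ of finitely supported signed measures on $X$ such that $\|\mu_n\|=1$ for every $n\in\omega$ and $\lim_{n\to\infty}\mu_n(f)=0$ for every $f\in C(X)$. *)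

(* Defs.v *)
From HB Require Import structures.
From mathcomp Require Import all_boot all_order all_algebra finmap.
From mathcomp Require Import all_classical all_reals all_analysis.

Set Implicit Arguments.
Unset Strict Implicit.
Unset Printing Implicit Defensive.

Import Order.TTheory GRing.Theory Num.Theory.
Import numFieldNormedType.Exports.

Local Open Scope classical_set_scope.
Local Open Scope ring_scope.

Definition tychonoff_space (X : topologicalType) : Prop :=
  hausdorff_space X /\ completely_regular_space X.

(* The measure [\sum_(x in F) alpha_x \d_x], with [F] finite and every [alpha_x]
   nonzero, is encoded by its coefficients: the finitely supported function equal
   to [alpha_x] at [x \in F] and to 0 elsewhere.  Its support [F] is
   [finsupp mu]. *)
Definition fs_measure (R : realType) (X : topologicalType) : Type :=
  {fsfun X -> R for fun=> 0}.

Definition fs_norm (R : realType) (X : topologicalType)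
    (mu : fs_measure R X) : R :=
  \sum_(x <- finsupp mu) `|mu x|.

Definition fs_integral (R : realType) (X : topologicalType)
    (mu : fs_measure R X) (f : X -> R) : R :=
  \sum_(x <- finsupp mu) mu x * f x.

Definition JN_sequence (R : realType) (X : topologicalType)
    (mu : nat -> fs_measure R X) : Prop :=
  (forall n, fs_norm (mu n) = 1) /\
  (forall f : X -> R, continuous f ->
     (fun n => fs_integral (mu n) f) @ \oo --> (0 : R)).

(* Main.v *)
Require Import Defs.
From HB Require Import structures.
From mathcomp Require Import all_boot all_order all_algebra finmap.
From mathcomp Require Import all_classical all_reals all_analysis.
From mathcomp Require Import lra.

(** Suppose some JN-sequence does not have supports of size tending to infinity.
    Pass to a subsequence with supports of constant size k, written
    mu_n = sum_(i < k) a_i(n) delta_(x_i(n)).  If for some i != j and some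
    subsequence f(x_i) - f(x_j) tends to 0 for every continuous f, then the
    measures (delta_(x_i) - delta_(x_j)) / 2 form a JN-sequence with supports of
    size 2.  Otherwise every pair i != j and every subsequence admit a further
    subsequence and a continuous g with g(x_i) = 0 and g(x_j) = 1 along it: by
    Efremovich's lemma the real sequences f(x_i) and f(x_j) have subsequences
    at positive distance.  Treating the finitely many pairs in turn, products of
    such g give continuous h_i with h_i(x_j) = [i = j] along one subsequence.
    Hence a_i = mu(h_i) tends to 0 for each i, contradicting
    sum_(i < k) |a_i| = 1. *)

Set Implicit Arguments.
Unset Strict Implicit.
Unset Printing Implicit Defensive.

Import Order.TTheory GRing.Theory Num.Theory.
Import numFieldNormedType.Exports.

Local Open Scope classical_set_scope.
Local Open Scope ring_scope.

(* Subsequences are only required to satisfy [n <= s n]: repetitions are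
   harmless for limits, this is stable under composition, and countable choice
   suffices to produce such an [s]. *)
Definition cofinal_seq (s : nat -> nat) : Prop := forall n, (n <= s n)%N.

Lemma cofinal_comp (s t : nat -> nat) :
  cofinal_seq s -> cofinal_seq t -> cofinal_seq (s \o t).
Proof. by move=> hs ht n; exact: leq_trans (ht n) (hs _). Qed.

Lemma cofinal_cvg (s : nat -> nat) : cofinal_seq s -> s @ \oo --> \oo.
Proof.
move=> hs; apply/cvgnyPge => A; near=> n; apply: leq_trans (hs n).
by near: n; exact: nbhs_infty_ge.
Unshelve. all: by end_near. Qed.

Lemma not_near_cofinal (P : nat -> Prop) : ~ (\forall n \near \oo, P n) ->
  exists2 s, cofinal_seq s & forall n, ~ P (s n).
Proof.
move=> nP; have /choice[s hs] : forall m, exists n, (m <= n)%N /\ ~ P n.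
  move=> m; apply: contrapT => no; apply: nP; exists m => //= n /= mn.
  by apply: contrapT => nPn; apply: no; exists n.
by exists s => n; have [] := hs n.
Qed.

(** The indices are treated one at a time, each refining the subsequence found so far; heredity of
    [Q] preserves what was already secured. *)
Lemma finite_refinement (I : finType) (Q : I -> (nat -> nat) -> Prop) :
  (forall i s t, Q i s -> Q i (s \o t)) ->
  (forall i s, cofinal_seq s -> exists2 t, cofinal_seq t & Q i (s \o t)) ->
  exists2 s, cofinal_seq s & forall i, Q i s.
Proof.
move=> Qsub Qex.
suff [s hs Qs] : exists2 s, cofinal_seq s & forall i, i \in enum I -> Q i s.
  by exists s => // i; apply: Qs; rewrite mem_enum.
elim: (enum I) => [|i r [s hs Qs]]; first by exists id.
have [t ht Qt] := Qex i s hs; exists (s \o t); first exact: cofinal_comp.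
move=> j; rewrite inE => /predU1P[->//|jr].
exact/Qsub/Qs.
Qed.

Lemma greedy_subsequence (P : nat -> nat -> Prop) :
  (forall m, \forall n \near \oo, P m n) ->
  exists2 s, cofinal_seq s & forall i j, (i < j)%N -> P (s i) (s j).
Proof.
move=> PP.
have /choice[N hN] : forall m, exists N, forall n, (N <= n)%N -> P m n.
  by move=> m; have [N _ hN] := PP m; exists N.
(* [F p] exceeds [p] and the thresholds [N m] of all [m <= p], the sum bounding their maximum. *)
pose F p := (p + \sum_(i < p.+1) N i).+1.
have NF m p : (m <= p)%N -> (N m <= F p)%N.
  rewrite -ltnS => mp; rewrite /F (bigD1 (Ordinal mp)) //=.
  by rewrite addnCA -addnS leq_addr.
pose s n := iter n F 0%N.
have sS n : (s n < s n.+1)%N by rewrite /s iterS /F ltnS leq_addr.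
have smono i j : (i <= j)%N -> (s i <= s j)%N.
  by apply: (homo_leq (r := leq)) => [//|? ? ?|n]; [exact: leq_trans|exact/ltnW].
exists s => [n|i [//|j]]; first by elim: n => // n IH; exact: leq_ltn_trans (sS n).
by rewrite ltnS => ij; apply: hN; rewrite {2}/s iterS; exact/NF/smono.
Qed.

Section Separation.
Variable R : realType.
Implicit Types (a b : nat -> R) (e : R).

Lemma clustered_subsequence a c e :
  ~ (\forall n \near \oo, e <= `|a n - c|) ->
  exists2 s, cofinal_seq s & forall m n, `|a (s m) - a (s n)| < e + e.
Proof.
move=> /not_near_cofinal[s hs as_]; exists s => // m n.
have close i : `|a (s i) - c| < e by rewrite ltNge; exact/negP/as_.
rewrite -(subrKA c) (le_lt_trans (ler_normD _ _))// ltrD//.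
by rewrite distrC.
Qed.

(* Efremovich's lemma on the real line.  Either one of the sequences has a
   subsequence contained in a small ball, or each term of one is eventually far
   from all the terms of the other and a greedy choice works. *)
Lemma efremovich a b e : 0 < e -> (forall n, e <= `|a n - b n|) ->
  exists2 s, cofinal_seq s & forall m n, e / 4 <= `|a (s m) - b (s n)|.
Proof.
move=> e0 ab.
have tri (u v w : R) : `|u - w| <= `|u - v| + `|v - w| by exact: ler_distD.
have [fara|/existsNP[c]] :=
  pselect (forall c, \forall n \near \oo, e / 4 <= `|a n - c|); last first.
  (* Terms of [a] now differ by less than [e / 2], so replacing [a (s n)] by [a (s m)] leaves a
     distance above [e / 2] to [b (s n)]. *)
  move=> /clustered_subsequence[s hs acl]; exists s => // m n.
  have := ab (s n); have := tri (a (s n)) (a (s m)) (b (s n)).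
  have := acl n m; lra.
have [farb|/existsNP[c]] :=
  pselect (forall c, \forall n \near \oo, e / 4 <= `|b n - c|); last first.
  move=> /clustered_subsequence[s hs bcl]; exists s => // m n.
  have := ab (s m); have := tri (a (s m)) (b (s n)) (b (s m)).
  have := bcl n m; lra.
(* The greedy choice only compares a term with later ones, so both orders of the indices are put
   into the relation. *)
have [m|s hs far] := @greedy_subsequence
    (fun m n => e / 4 <= `|a m - b n| /\ e / 4 <= `|a n - b m|).
  apply: filterS2 (farb (a m)) (fara (b m)) => n.
  by rewrite distrC.
exists s => // m n; have [mn|nm|->] := ltngtP m n.
- by have [] := far _ _ mn.
- by have [] := far _ _ nm.
- have := ab (s n); lra.
Qed.

(** The entourage of radius [e] misses the product of [A] and [B], so the uniform version of
    Urysohn's lemma applies. *)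
Lemma separating_function (A B : set R) e : 0 < e ->
  (forall x y, A x -> B y -> e <= `|x - y|) ->
  exists2 g : R -> R, continuous g &
    (forall x, A x -> g x = 0) /\ (forall y, B y -> g y = 1).
Proof.
move=> e0 AB.
have /(@uniform_separatorP _ R)[g [gc _ gA gB]] : uniform_separator A B.
  apply: uniform_separatorW; exists [set xy | ball xy.1 e xy.2].
    exact: entourage_ball (PosNum e0).
  rewrite -subset0 => -[x y] [[/= Ax By]] /=.
  by rewrite -ball_normE /ball_ /= ltNge AB.
exists g => //; split=> x hx; [apply: gA|apply: gB]; by exists x.
Qed.

(** The separation is done among the values of [f] on the real line and pulled back along [f]. *)
Lemma separating_subsequence (X : topologicalType) (x y : nat -> X)
    (f : X -> R) : continuous f ->
  ~ ((fun n => f (x n) - f (y n)) @ \oo --> (0 : R)) ->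
  exists s (g : X -> R), [/\ cofinal_seq s, continuous g &
    forall n, g (x (s n)) = 0 /\ g (y (s n)) = 1].
Proof.
move=> fc /cvgrPdist_lt /existsNP[e /not_implyP[e0]].
move=> /not_near_cofinal[s hs sfar].
have {}sfar n : e <= `|f (x (s n)) - f (y (s n))|.
  by rewrite leNgt; apply/negP; have := sfar n; rewrite sub0r normrN.
have [t ht tfar] := efremovich e0 sfar.
pose u := s \o t.
have [||g gc [g0 g1]] := @separating_function
  (range (f \o x \o u)) (range (f \o y \o u)) (e / 4).
- by lra.
- by move=> _ _ [m _ <-] [n _ <-]; exact: tfar.
exists u, (g \o f); split; first exact: cofinal_comp.
  by move=> z; apply: continuous_comp; [exact: fc|exact: gc].
by move=> n; split; [apply: g0|apply: g1]; exists n.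
Qed.

End Separation.

Lemma dual_functions (R : realType) (X : topologicalType) (I : finType)
    (x : I -> nat -> X) :
  (forall i j, i != j -> forall s, cofinal_seq s -> exists2 f : X -> R,
     continuous f & ~ ((fun n => f (x i (s n)) - f (x j (s n))) @ \oo --> (0 : R))) ->
  exists s (h : I -> X -> R), [/\ cofinal_seq s, forall i, continuous (h i) &
    forall i j n, h i (x j (s n)) = (i == j)%:R].
Proof.
move=> sep.
pose Q (p : I * I) (s : nat -> nat) := p.1 != p.2 -> exists2 g : X -> R, continuous g &
  forall n, g (x p.1 (s n)) = 0 /\ g (x p.2 (s n)) = 1.
have [p s t Qs /Qs[g gc gs]|[i j] s hs|s hs Qs] := @finite_refinement _ Q.
- by exists g => // n; exact: gs.
- have [->|ij] := eqVneq i j; first by exists id => //; rewrite /Q/= eqxx.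
  have [f fc fs] := sep i j ij s hs.
  have [t [g [ht gc gt]]] := separating_subsequence fc fs.
  by exists t => // _; exists g.
have /choice[g hg] : forall p : I * I, exists g : X -> R, continuous g /\
    (p.1 != p.2 -> forall n, g (x p.1 (s n)) = 0 /\ g (x p.2 (s n)) = 1).
  move=> p; have [/Qs[g gc gs]|pp] := boolP (p.1 != p.2); first by exists g.
  by exists (cst 0); split => // z; exact: cvg_cst.
(* Along [s], the factor [g (j, i)] is 0 at [x j] and 1 at [x i]. *)
exists s, (fun i z => \prod_(j | j != i) g (j, i) z); split => //.
- by move=> i; apply: continuous_big => [|j _]; [exact: mul_continuous|exact: (hg _).1].
- move=> i j n; have [<-|ij] := eqVneq i j.
    by rewrite big1 // => l li; have [_ /(_ li n)[]] := hg (l, i).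
  have ji : j != i by rewrite eq_sym.
  by rewrite (bigD1 j) //=; have [_ /(_ ji n)[->]] := hg (j, i); rewrite mul0r.
Qed.

Section FinitelySupported.
Variables (R : realType) (X : topologicalType).
Implicit Types (mu : nat -> fs_measure R X) (x y : X) (f : X -> R).

Lemma JN_subsequence mu s : JN_sequence mu -> cofinal_seq s ->
  JN_sequence (mu \o s).
Proof.
move=> [mu1 mu0] hs; split=> [n|f fc]; first exact: mu1.
exact: (cvg_comp _ _ (cofinal_cvg hs) (mu0 f fc)).
Qed.

(** For [x != y] this is (delta_x - delta_y) / 2; for [x = y] it degenerates to delta_x / 2. *)
Definition dipole x y : fs_measure R X :=
  [fsfun z in [fset x; y]%fset => if z == x then 2^-1 else - 2^-1].

Lemma finsupp_dipole x y : finsupp (dipole x y) = [fset x; y]%fset.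
Proof.
apply/fsetP => z; rewrite mem_finsupp fsfunE.
case: ifP => _; last by rewrite eqxx.
by case: ifP => _; rewrite ?oppr_eq0 invr_eq0 pnatr_eq0.
Qed.

Lemma big_dipole x y (F : X -> R) : x != y ->
  \sum_(z <- finsupp (dipole x y)) F z = F x + F y.
Proof.
by move=> xy; rewrite finsupp_dipole big_fsetU1 ?inE//= big_seq_fset1.
Qed.

Lemma dipolel x y : dipole x y x = 2^-1.
Proof. by rewrite fsfunE !inE eqxx. Qed.

Lemma dipoler x y : x != y -> dipole x y y = - 2^-1.
Proof. by move=> xy; rewrite fsfunE !inE eqxx orbT eq_sym (negPf xy). Qed.

Lemma fs_norm_dipole x y : x != y -> fs_norm (dipole x y) = 1.
Proof.
move=> xy; rewrite /fs_norm big_dipole// dipolel dipoler// normrN.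
by rewrite ger0_norm ?invr_ge0 ?ler0n//; lra.
Qed.

Lemma fs_integral_dipole x y f : x != y ->
  fs_integral (dipole x y) f = 2^-1 * (f x - f y).
Proof.
by move=> xy; rewrite /fs_integral big_dipole// dipolel dipoler//; lra.
Qed.

Lemma JN_dipole (x y : nat -> X) : (forall n, x n != y n) ->
  (forall f, continuous f ->
     (fun n => f (x n) - f (y n)) @ \oo --> (0 : R)) ->
  JN_sequence (fun n => dipole (x n) (y n)).
Proof.
move=> xy xy0; split=> [n|f fc]; first exact: fs_norm_dipole.
under eq_fun do rewrite fs_integral_dipole//.
by rewrite -(mulr0 2^-1); apply: cvgMr; exact: xy0.
Qed.

Lemma JN_close_points mu k : JN_sequence mu ->
  (forall n, #|` finsupp (mu n)| = k) ->
  exists x y : nat -> X, (forall n, x n != y n) /\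
    forall f, continuous f -> (fun n => f (x n) - f (y n)) @ \oo --> (0 : R).
Proof.
move=> JNmu suppk; have [mu1 mu0] := JNmu; apply: contrapT => noxy.
(* Norm 1 forces a nonempty support, which provides the default value for [nth]. *)
have [z0 _] : exists z, z \in finsupp (mu 0%N).
  apply/fset0Pn/eqP => supp0; have /eqP := mu1 0%N.
  by rewrite /fs_norm supp0 big_seq_fset0 eq_sym oner_eq0.
pose x (i : 'I_k) n := nth z0 (finsupp (mu n)) i.
have sumE (F : X -> R) n : \sum_(z <- finsupp (mu n)) F z = \sum_i F (x i n).
  by rewrite (big_nth z0) big_mkord suppk.
have [i j ij s hs|s [h [hs hc hx]]] := @dual_functions R X _ x.
  apply: contrapT => nof; apply: noxy; exists (x i \o s), (x j \o s).
  split=> [n|f fc]; first by rewrite /= nth_uniq ?suppk ?fset_uniq.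
  by apply: contrapT => nf; apply: nof; exists f.
(* The coefficient at [x i (s n)] is exactly the integral of [h i]. *)
have coef0 i : (fun n => mu (s n) (x i (s n))) @ \oo --> (0 : R).
  have [_ /(_ _ (hc i))] := JN_subsequence JNmu hs.
  apply: cvg_trans; apply: near_eq_cvg; near=> n.
  rewrite /fs_integral sumE (bigD1 i)//= hx eqxx mulr1 big1 ?addr0// => j ji.
  by rewrite hx eq_sym (negPf ji) mulr0.
have : (fun n => \sum_i `|mu (s n) (x i (s n))|) @ \oo --> (\sum_(i < k) `|0 : R|).
  by apply: cvg_big => [|i _]; [exact: add_continuous|exact: cvg_norm].
under eq_fun => n do rewrite -(sumE (fun z => `|mu (s n) z|)) -/(fs_norm _) mu1.
rewrite big1 ?normr0// => /cvg_lim -/(_ (@Rhausdorff R)).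
by rewrite lim_cst// => /eqP; rewrite oner_eq0.
Unshelve. all: by end_near. Qed.

End FinitelySupported.

Theorem corollary1p5 (R : realType) (X : topologicalType)
    (tychX : tychonoff_space X)
    (exJN : exists mu : nat -> fs_measure R X, JN_sequence mu) :
  (exists mu : nat -> fs_measure R X,
     JN_sequence mu /\ forall n, #|` finsupp (mu n)| = 2%N)
  \/
  (forall mu : nat -> fs_measure R X, JN_sequence mu ->
     (fun n => #|` finsupp (mu n)|) @ \oo --> \oo).
Proof.
have [?|no2] := pselect (exists mu : nat -> fs_measure R X,
  JN_sequence mu /\ forall n, #|` finsupp (mu n)| = 2%N); [by left|right].
move=> mu JNmu; apply/cvgnyPge => A.
(* Each of the finitely many sizes below [A] is eventually avoided: one that recurs forever would
   yield a JN-sequence of dipoles. *)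
have near_ne : \forall n \near \oo, forall k : 'I_A, #|` finsupp (mu n)| <> k.
  apply: filter_forall => k; apply: contrapT => /not_near_cofinal[s hs suppk].
  have {}suppk n : #|` finsupp ((mu \o s) n)| = k by apply: contrapT; exact: suppk.
  have [x [y [xy xy0]]] := JN_close_points (JN_subsequence JNmu hs) suppk.
  apply: no2; exists (fun n => dipole R (x n) (y n)); split; first exact: JN_dipole.
  by move=> n; rewrite finsupp_dipole cardfs2 xy.
near=> n; rewrite leqNgt; apply/negP => ltA.
by have /(_ (Ordinal ltA)) : forall k : 'I_A, #|` finsupp (mu n)| <> k by near: n.
Unshelve. all: by end_near. Qed.
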